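(* Let $\Gamma$ be a doubling planar graph. Then there is a constant $\alpha$ such that for every vertex $v$ of $\Gamma$ and every integer $n \ge 1$ there is a finite domain $\Omega$ in $\Gamma$ such that $B(v,n) \subset \Omega$, $\partial \Omega \subset B(v,6n)$ and $|\partial \Omega| \leq \alpha n$.
   Context: Graphs are locally finite, and the vertex set of a graph $\Gamma$ carries the path metric $d$ in which every edge has length $1$. For a vertex $a$ of $\Gamma$ and a positive integer $n$, $B(a,n)$ denotes the ball of radius $n$ centered at $a$ (the vertices at distance at most $n$ from $a$, with the edges between them), and $V(a,n) = |B(a,n)|$, where $|B|$ denotes the number of vertices of $B$. A graph $\Gamma$ is doubling if there is a constant $C>0$ such that $V(a,2n) \leq C\,V(b,n)$ for all vertices $a,b$ of $\Gamma$ and all positive integers $n$. A domain in $\Gamma$ is a connected subgraph of $\Gamma$; it is finite if it has finitely many vertices. The inclusion $B(v,n)\subset\Omega$ means that every vertex of $B(v,n)$ is a vertex of $\Omega$. For a subgraph $\Omega$ of $\Gamma$, $\partial \Omega$ denotes the set of all vertices of $\Gamma$ not in $\Omega$ that have a neighbor in $\Omega$, and $|\partial\Omega|$ is its cardinality. *)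

(* Defs.v *)
From mathcomp Require Import all_boot all_order all_algebra.
From mathcomp Require Import finmap.
From mathcomp Require Import all_classical all_reals all_analysis.

Set Implicit Arguments.
Unset Strict Implicit.
Unset Printing Implicit Defensive.

Import Order.TTheory GRing.Theory Num.Theory.
Import numFieldNormedType.Exports.

Local Open Scope classical_set_scope.
Local Open Scope ring_scope.

(* A (simple) graph is a symmetric irreflexive relation e on a vertex type V,
   possibly infinite. *)

Definition locally_finite (V : choiceType) (e : rel V) : Prop :=
  forall x : V, finite_set [set y | e x y].

(* [set y | d(a, y) <= n] for the path metric d; d is infinite between distinct
   connected components, so connectedness need not be assumed. *)
Definition gball (V : choiceType) (e : rel V) (a : V) (n : nat) : set V :=
  [set y | exists p : seq V, [/\ path e a p, last a p = y & (size p <= n)%N]].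

(* Number of elements of a finite set; 0 by convention on infinite sets. *)
Definition nb_vertices (V : choiceType) (A : set V) : nat := #|` fset_set A|.

Definition volume (V : choiceType) (e : rel V) (a : V) (n : nat) : nat :=
  nb_vertices (gball e a n).

Definition doubling (R : realType) (V : choiceType) (e : rel V) : Prop :=
  exists2 C : R, 0 < C &
    forall (a b : V) (n : nat), (0 < n)%N ->
      (volume e a (2 * n))%:R <= C * (volume e b n)%:R.

(* Vertices are drawn as distinct points [pos x] of the plane R * R, and an edge
   {x, y} as a simple arc [arc x y], parametrized by [0, 1] from x to y; the
   parametrization from y to x is the reversed one. An arc meets the rest of the
   drawing only at its endpoints. Values of [arc] off the edges are junk. *)
Record plane_drawing (R : realType) (V : choiceType) (e : rel V)
    (pos : V -> R * R) (arc : V -> V -> R -> R * R) : Prop := PlaneDrawing {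
  drawing_pos_inj : injective pos;
  drawing_arc_cont : forall x y, e x y ->
    {within `[0, 1], continuous (arc x y)};
  drawing_arc_inj : forall x y, e x y ->
    {in `[0, 1] &, injective (arc x y)};
  drawing_arc0 : forall x y, e x y -> arc x y 0 = pos x;
  drawing_arc1 : forall x y, e x y -> arc x y 1 = pos y;
  drawing_arc_rev : forall x y, e x y ->
    {in `[0, 1], forall t, arc y x t = arc x y (1 - t)};
  drawing_arc_vertex : forall x y z, e x y ->
    {in `]0, 1[, forall t, arc x y t <> pos z};
  drawing_arc_disjoint : forall x y x' y', e x y -> e x' y' ->
    (x', y') <> (x, y) -> (x', y') <> (y, x) ->
    {in `]0, 1[ &, forall s t, arc x y s <> arc x' y' t}
}.

Definition planar (R : realType) (V : choiceType) (e : rel V) : Prop :=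
  exists (pos : V -> R * R) (arc : V -> V -> R -> R * R),
    plane_drawing e pos arc.

(* Subgraphs need not be induced. *)
Record subgraph (V : choiceType) (e : rel V) := Subgraph {
  sub_vertices : set V;
  sub_edge : rel V;
  sub_edge_sym : symmetric sub_edge;
  sub_edge_graph : forall x y, sub_edge x y -> e x y;
  sub_edge_vertex : forall x y, sub_edge x y -> sub_vertices x
}.

Definition sub_connected (V : choiceType) (e : rel V) (W : subgraph e) : Prop :=
  forall x y, sub_vertices W x -> sub_vertices W y ->
    exists2 p : seq V, path (sub_edge W) x p & last x p = y.

Definition finite_domain (V : choiceType) (e : rel V) (W : subgraph e) : Prop :=
  finite_set (sub_vertices W) /\ sub_connected W.

Definition boundary (V : choiceType) (e : rel V) (W : subgraph e) : set V :=
  [set x | ~ sub_vertices W x /\ exists2 y, sub_vertices W y & e x y].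

(* Main.v *)
Require Import Defs.
From mathcomp Require Import all_boot all_order all_algebra.
From mathcomp Require Import finmap.
From mathcomp Require Import all_classical all_reals all_analysis.
From mathcomp Require Import ring lra zify.

Set Implicit Arguments.
Unset Strict Implicit.
Unset Printing Implicit Defensive.

Import Order.TTheory GRing.Theory Num.Theory.
Import numFieldNormedType.Exports.

Local Open Scope classical_set_scope.
Local Open Scope ring_scope.

(** A small cut around [gball e v n] comes from Menger's theorem: a set of
vertices separates that ball from a far connected set [K] unless many disjoint
paths run from the ball to [K], and planarity together with doubling leaves
room for [O(n)] such paths only.

Let [P 1, ..., P m] be disjoint paths from [A := gball e v n] to a component
[K] of the complement of [gball e v (5 * n)]. Each has a point [z i] at distance
exactly [3 * n] from [v]. By doubling, a family of disjoint balls of radius [n]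
centred on that sphere has bounded size, so there are boundedly many of these
points, the centres, such that every [z i] is within [2 * n] steps of a centre
([net]), along walks that avoid [A] and [K]. It remains to see that [k] steps off
[A] and [K] from a centre [y] lead to at most [2 * k + 1] of the paths
([saturated_growth]). Grow a connected set
[Q] around [y] one step at a time, swallowing each path as soon as it is touched,
the path through [y] to begin with. If one step touched three new paths, then [A],
[K] and [Q] would be three disjoint connected sets, each adjacent to each of three
disjoint connected sets: a [K_{3,3}] minor ([no_tripod], [planar_no_K33]). Hence
[m <= M * (4 * n + 1)] ([crossing_bound]), and Menger's theorem
([menger], by Goering's induction on the edges) gives a cut of that size
([small_cut]). Only components of the complement of [gball e v (5 * n)] that
leave [gball e v (6 * n)] need to be cut off, and boundedly many components do;
the component of [v] off the union of their cuts is the required domain.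

The topological input is that [K_{3,3}] is not planar for merely continuous
arcs. It is used in the strong form that nine plane continua [M i j] joining
[a i] to [b j] cannot have [M i j] disjoint from [M k l] whenever [i <> k] and
[j <> l] ([K33_continua]), so the branch sets of the minor may be joined by
arbitrary walks. Write [T(q; c)] for the angle by which the direction
from [q] turns along a curve [c]. If [c] and [c'] are disjoint, moving one end of
a segment along [c] and the other along [c'], in either order, turns it by the
same total angle, so
[T(start c'; c) + T(end c; c') = T(start c; c') + T(end c'; c)].
Summing these relations over [c : a (i + 1) -> b j] and [c' : a i -> b l], with
[i] cyclic modulo 3 and [j <> l], the terms seen from the [b]'s cancel and
the others occur twice; what is left is an identity between turns of
[a k -> b l] seen from [a (k + 1)] and of [a (k + 1) -> b l] seen from
[a k]. Modulo full turns the directions of the [b l] contribute the same to both sides,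
and the opposite directions of [a k - a (k + 1)] and [a (k + 1) - a k] make the
sides differ by one half turn for each of the nine pairs [(k, l)]: an odd number.
Angles are replaced by the integer number of half turns along fine chains of
points. *)

(** * Walks inside a set *)

Lemma setI0_absurd (T : Type) (X Y : set T) (x : T) :
  X `&` Y = set0 -> X x -> Y x -> False.
Proof. by move=> XY Xx Yx; have : (X `&` Y) x by []; rewrite XY. Qed.

Inductive walk (T : eqType) (r : rel T) (D : set T) (x : T) : T -> Prop :=
| walk0 : D x -> walk r D x x
| walkS y z : walk r D x y -> r y z -> D z -> walk r D x z.

Lemma walk_mem (T : eqType) (r : rel T) (D : set T) (x y : T) :
  walk r D x y -> D x /\ D y.
Proof. by elim=> // z z' _ [? _]. Qed.

Lemma walk_path (T : eqType) (r : rel T) (D : set T) (x y : T) : walk r D x y ->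
  exists p, [/\ path r x p, last x p = y & {in x :: p, forall z, D z}].
Proof.
elim=> [Dx|y' z _ [p [rp ly Dp]] ryz Dz].
  by exists [::]; split=> // z; rewrite inE => /eqP->.
exists (rcons p z); rewrite rcons_path last_rcons rp ly; split=> // w.
by rewrite -rcons_cons mem_rcons inE => /orP[/eqP->//|]; exact: Dp.
Qed.

Lemma walk_sub (T : eqType) (r r' : rel T) (D D' : set T) (x y : T) :
  {in D &, subrel r r'} -> D `<=` D' -> walk r D x y -> walk r' D' x y.
Proof.
move=> rr' DD'; elim=> [Dx|z z' xz IH rzz' Dz']; first by apply: walk0; exact: DD'.
apply: walkS IH _ (DD' _ Dz'); apply: rr' => //; rewrite inE //.
by case: (walk_mem xz).
Qed.

Lemma walkW (T : eqType) (r : rel T) (D D' : set T) (x y : T) :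
  D `<=` D' -> walk r D x y -> walk r D' x y.
Proof. exact: walk_sub. Qed.

Lemma walk_trans (T : eqType) (r : rel T) (D : set T) (y x z : T) :
  walk r D x y -> walk r D y z -> walk r D x z.
Proof. by move=> xy; elim=> // w w' _; exact: walkS. Qed.

Lemma walk1 (T : eqType) (r : rel T) (D : set T) (x y : T) :
  D x -> D y -> r x y -> walk r D x y.
Proof. by move=> Dx Dy rxy; apply: walkS rxy Dy; exact: walk0. Qed.

Lemma walk_rev (T : eqType) (r : rel T) (D : set T) (x y : T) :
  walk r D x y -> walk (fun u v => r v u) D y x.
Proof.
elim=> [|z z' xz IH rzz' Dz']; first exact: walk0.
by apply: walk_trans IH; apply: walk1 => //; case: (walk_mem xz).
Qed.

Lemma walk_sym (T : eqType) (r : rel T) (D : set T) (x y : T) :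
  symmetric r -> walk r D x y -> walk r D y x.
Proof. by move=> rs /walk_rev; apply: walk_sub => // u v _ _; rewrite rs. Qed.

Definition walk_connected (T : eqType) (r : rel T) (W : set T) : Prop :=
  forall x y, W x -> W y -> walk r W x y.

Lemma walk_connected_from (T : eqType) (e : rel T) (W : set T) (x : T) :
  symmetric e -> (forall y, W y -> walk e W x y) -> walk_connected e W.
Proof.
move=> es h y z /h xy /h xz; apply: walk_trans xz; exact: walk_sym.
Qed.

Lemma walk_component (T : eqType) (e : rel T) (D : set T) (x y : T) :
  walk e D x y -> walk e [set z | walk e D x z] x y.
Proof.
elim=> [Dx|u z w IH uz Dz]; first by apply: walk0; exact: walk0.
by apply: (walkS IH uz); exact: (walkS w uz).
Qed.

Lemma walk_connected_component (T : eqType) (e : rel T) (D : set T) (x : T) :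
  symmetric e -> walk_connected e [set z | walk e D x z].
Proof. by move=> es; apply: (walk_connected_from es) => y; exact: walk_component. Qed.

Lemma walk_exit (T : eqType) (r : rel T) (D B : set T) (x y : T) :
  walk r D x y -> B x -> ~ B y -> exists u w, [/\ D u, B u, ~ B w & r u w].
Proof.
elim=> [//|z w xz IH zw Dw Bx nBw].
have [Bz|nBz] := pselect (B z); last exact: IH.
by exists z, w; have [_ Dz] := walk_mem xz.
Qed.

(** Cutting a walk at its first visit to the endpoint [y]: every other vertex kept
is reached before [y]. *)
Lemma walk_first (T : eqType) (r : rel T) (D : set T) (x y : T) :
  walk r D x y -> walk r ([set z | walk r (D `\ y) x z] `|` [set y]) x y.
Proof.
set C := _ `|` _ => xy.
have [-> |/eqP xy0] := eqVneq x y; first by apply: walk0; right.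
have Dx : D x by case: (walk_mem xy).
suff H z : walk r D x z -> walk r C x y \/ walk r (D `\ y) x z /\ walk r C x z.
  by have [//|[xx _]] := H _ xy; have [_ [_ /(_ erefl)]] := walk_mem xx.
elim=> [_|z' w xz' [|[h1 h2]] zw Dw]; last 1 first.
- have [wy|/eqP wy] := eqVneq w y; first by left; rewrite -wy; apply: walkS h2 zw _; right.
  have h3 : walk r (D `\ y) x w by apply: walkS h1 zw _.
  by right; split=> //; apply: walkS h2 zw _; left.
- have h : walk r (D `\ y) x x by apply: walk0.
  by right; split=> //; apply: walk0; left.
- by left.
Qed.

Lemma walk_last (T : eqType) (r : rel T) (D : set T) (x y : T) :
  walk r D x y -> walk r ([set z | walk r (D `\ x) z y] `|` [set x]) x y.
Proof.
move=> /walk_rev/walk_first/walk_rev; apply: walkW => z [h|->]; last by right.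
by left; exact: walk_rev h.
Qed.

(** * Half turns of plane vectors *)

(** The half-plane is half-open so that exactly one of [u] and [- u] is in it
([upN]). *)
Definition up (R : realType) (u : R * R) : bool :=
  (0 < u.2) || (u.2 == 0) && (0 < u.1).

Definition det2 (R : realType) (u w : R * R) : R := u.1 * w.2 - u.2 * w.1.

Definition dot2 (R : realType) (u w : R * R) : R := u.1 * w.1 + u.2 * w.2.

(** Signed number of times that the line spanned by the first axis is crossed when
turning from [u] to [w] through the smaller angle, counterclockwise crossings
counting [1]. *)
Definition half_turn (R : realType) (u w : R * R) : int :=
  if up u == up w then 0 else if 0 < det2 u w then 1 else -1.

Lemma upN (R : realType) (u : R * R) : u != 0 -> up (- u) = ~~ up u.
Proof.
case: u => x y; rewrite /up /= => nz.
rewrite !oppr_gt0 oppr_eq0.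
have [y0|y0|y0] := ltgtP y 0; rewrite ?orbT //=.
have [x0|x0|x0] //= := ltgtP x 0.
by move: nz; rewrite x0 y0 eqxx.
Qed.

Lemma dot2_neq0 (R : realType) (l u : R * R) : 0 < dot2 l u -> u != 0.
Proof.
by apply: contraTneq => ->; rewrite /dot2 /= !mulr0 addr0 ltxx.
Qed.

(** In the linear relation between [u], [v] and [w], the coefficients are the three
determinants; if the conclusion failed, the vector [l] would fix the sign of the
third one, and all terms would lie on one side of the first axis. *)
Lemma det2_gt0_same_side (R : realType) (u v w : R * R) :
  up u -> up w -> ~~ up v -> (exists l, [/\ 0 < dot2 l u, 0 < dot2 l v & 0 < dot2 l w]) ->
  0 < det2 u v -> 0 < det2 w v.
Proof.
case: u v w => [u1 u2] [v1 v2] [w1 w2]; rewrite /up /det2 /dot2 /=.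
move=> hu hw hv [[l1 l2] /= [lu lv lw]] duv; rewrite ltNge; apply/negP => dwv.
have u2_ge : 0 <= u2 by case/orP: hu => [/ltW //|/andP[/eqP-> _]].
have w2_ge : 0 <= w2 by case/orP: hw => [/ltW //|/andP[/eqP-> _]].
have v2_le : v2 <= 0 by move: hv; rewrite negb_or -leNgt => /andP[].
set a := v1 * w2 - v2 * w1; set b := w1 * u2 - w2 * u1; set c := u1 * v2 - u2 * v1.
have a_ge : 0 <= a by rewrite /a; lra.
have c_gt : 0 < c by rewrite /c; lra.
have e1 : a * u1 + b * v1 + c * w1 = 0 by rewrite /a /b /c; ring.
have e2 : a * u2 + b * v2 + c * w2 = 0 by rewrite /a /b /c; ring.
have b_lt : b < 0.
  have : a * (l1 * u1 + l2 * u2) + b * (l1 * v1 + l2 * v2)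
         + c * (l1 * w1 + l2 * w2) = 0.
    transitivity (l1 * (a * u1 + b * v1 + c * w1) + l2 * (a * u2 + b * v2 + c * w2)).
      by ring.
    by rewrite e1 e2; ring.
  have := mulr_ge0 a_ge (ltW lu); have := mulr_gt0 c_gt lw.
  move=> h1 h2 h3; rewrite -(pmulr_llt0 _ lv); lra.
have t1 := mulr_ge0 a_ge u2_ge; have t3 := mulr_ge0 (ltW c_gt) w2_ge.
have t2 : 0 <= b * v2 by apply: mulr_le0 => //; exact: ltW.
have /eqP : c * w2 = 0 by lra.
rewrite mulf_eq0 (gt_eqF c_gt) /= => /eqP w20.
have /eqP : b * v2 = 0 by lra.
rewrite mulf_eq0 (lt_eqF b_lt) /= => /eqP v20.
move: hw; rewrite w20 ltxx eqxx /= => w1_gt.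
move: hv; rewrite v20 ltxx eqxx /= -leNgt => v1_le.
have a0 : a = 0 by rewrite /a w20 v20; ring.
have := mulr_gt0 c_gt w1_gt; have : 0 <= b * v1 by apply: mulr_le0 => //; exact: ltW.
by move: e1; rewrite a0 mul0r; lra.
Qed.

Lemma half_turnN (R : realType) (u w : R * R) : u != 0 -> w != 0 ->
  half_turn (- u) (- w) = half_turn u w.
Proof.
move=> u0 w0; rewrite /half_turn !upN // (inj_eq negb_inj).
by have -> : det2 (- u) (- w) = det2 u w by rewrite /det2 /=; ring.
Qed.

Lemma half_turn_opp (R : realType) (l u v : R * R) :
  0 < dot2 l u -> 0 < dot2 l v -> half_turn v u = - half_turn u v.
Proof.
move=> lu lv; rewrite /half_turn eq_sym; case: eqP => [_|/eqP ne]; first by rewrite oppr0.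
have -> : det2 v u = - det2 u v by rewrite /det2; ring.
have : det2 u v != 0.
  apply/eqP => d0; move: ne; case: l u v d0 lu lv => [l1 l2] [u1 u2] [v1 v2].
  rewrite /det2 /dot2 /up /= => d0 lu lv.
  set a := _ + _ in lu; set b := _ + _ in lv.
  have e1 : a * v1 = b * u1.
    apply/eqP; rewrite -subr_eq0; apply/eqP.
    by transitivity (- l2 * (u1 * v2 - u2 * v1)); [rewrite /a /b; ring|rewrite d0 mulr0].
  have e2 : a * v2 = b * u2.
    apply/eqP; rewrite -subr_eq0; apply/eqP.
    by transitivity (l1 * (u1 * v2 - u2 * v1)); [rewrite /a /b; ring|rewrite d0 mulr0].
  rewrite -(pmulr_rgt0 v2 lu) -(pmulr_rgt0 v1 lu) e1 e2 !pmulr_rgt0 //.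
  have -> : (v2 == 0) = (u2 == 0).
    have := congr1 (fun z => z == 0) e2; rewrite !mulf_eq0.
    by rewrite (gt_eqF lu) (gt_eqF lv).
  by rewrite eqxx.
by rewrite oppr_gt0; case: ltgtP => //; rewrite ?opprK.
Qed.

(** Vectors in a common open half-plane cannot wind around the origin, so half turns
add up there. *)
Lemma half_turn_add (R : realType) (l u v w : R * R) :
  0 < dot2 l u -> 0 < dot2 l v -> 0 < dot2 l w ->
  half_turn u v + half_turn v w = half_turn u w.
Proof.
(* negating all the vectors reduces [key] to the case [up a] *)
have key (l' a b c : R * R) : 0 < dot2 l' a -> 0 < dot2 l' b -> 0 < dot2 l' c ->
    up a = up c -> up b != up a -> half_turn a b = half_turn c b.
  move=> la lb lc eac nab; rewrite /half_turn -eac eq_sym (negbTE nab).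
  suff -> : (0 < det2 a b) = (0 < det2 c b) by [].
  have dotN (x : R * R) : dot2 (- l') (- x) = dot2 l' x by rewrite /dot2 /=; ring.
  have detN (x y : R * R) : det2 (- x) (- y) = det2 x y by rewrite /det2 /=; ring.
  have [ua|ua] := boolP (up a).
    move: nab; rewrite ua eqb_id => nub.
    by apply/idP/idP; apply: det2_gt0_same_side => //; rewrite -?eac //; exists l'.
  have ub : up b by move: nab; rewrite (negbTE ua); case: (up b).
  have na := dot2_neq0 la; have nb := dot2_neq0 lb; have nc := dot2_neq0 lc.
  rewrite -(detN a b) -(detN c b).
  by apply/idP/idP; apply: det2_gt0_same_side; rewrite ?upN ?negbK -?eac //;
    exists (- l'); rewrite !dotN.
move=> lu lv lw.
have [euv|nuv] := eqVneq (up u) (up v); have [evw|nvw] := eqVneq (up v) (up w).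
- by rewrite /half_turn euv evw eqxx addr0.
- rewrite [half_turn u v]/half_turn euv eqxx add0r.
  by rewrite (@key l u w v) // euv eq_sym.
- rewrite [half_turn v w]/half_turn evw eqxx addr0.
  rewrite (half_turn_opp lv lu) (half_turn_opp lw lu); congr (- _).
  by apply: (@key l v u w).
- have euw : up u = up w by move: nuv nvw; case: (up u); case: (up v); case: (up w).
  rewrite (@key l u v w) // 1?eq_sym //.
  by rewrite (half_turn_opp lv lw) addNr /half_turn euw eqxx.
Qed.

(** Nearness in the sup norm, the one carried by the product [R * R]. *)
Definition near_pt (R : realType) (d : R) (p q : R * R) : bool :=
  (`|p.1 - q.1| < d) && (`|p.2 - q.2| < d).

Lemma near_ptxx (R : realType) (d : R) (p : R * R) : 0 < d -> near_pt d p p.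
Proof. by move=> d0; rewrite /near_pt !subrr normr0 d0. Qed.

Lemma near_ptC (R : realType) (d : R) (p q : R * R) : near_pt d p q = near_pt d q p.
Proof. by rewrite /near_pt distrC [X in _ && (X < _)]distrC. Qed.

Lemma near_ptW (R : realType) (d d' : R) (p q : R * R) :
  d <= d' -> near_pt d p q -> near_pt d' p q.
Proof. by move=> dd' /andP[h1 h2]; rewrite /near_pt !(lt_le_trans _ dd'). Qed.

(** The difference [p - q] has a coordinate of size at least [4 * d], whose sign
survives perturbations of [p] and [q] by less than [d]. *)
Lemma near_pt_half_plane (R : realType) (d : R) (p q : R * R) :
  ~~ near_pt (4 * d) p q ->
  exists l, forall p' q', near_pt d p p' -> near_pt d q q' -> 0 < dot2 l (p' - q').
Proof.
case: p q => [p1 p2] [q1 q2]; rewrite /near_pt /= => far.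
have sq (x y z : R) : 4 * d <= `|x| -> `|x - y| < 2 * d -> 0 < x * y.
  move=> xd; rewrite ltr_norml => /andP[h1 h2].
  move: xd; have [x0|x0] := lerP 0 x; [rewrite ger0_norm // | rewrite ltr0_norm //] => xd.
    by apply: mulr_gt0; lra.
  by rewrite nmulr_rgt0 //; lra.
have tri (x x' y y' : R) : `|x - x'| < d -> `|y - y'| < d -> `|(x - y) - (x' - y')| < 2 * d.
  move=> h1 h2; rewrite (_ : _ - _ = (x - x') - (y - y')); last by ring.
  by apply: le_lt_trans (ler_normB _ _) _; lra.
case/nandP: far; rewrite -leNgt => far.
  exists (p1 - q1, 0) => -[p1' p2'] [q1' q2'] /= /andP[h1 _] /andP[h2 _].
  by rewrite /dot2 /= mul0r addr0; apply: sq => //; exact: tri.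
exists (0, p2 - q2) => -[p1' p2'] [q1' q2'] /= /andP[_ h1] /andP[_ h2].
by rewrite /dot2 /= mul0r add0r; apply: sq => //; exact: tri.
Qed.

(** Number of half turns made by the direction from [q] to a point running through
the chain [p :: s]. *)
Fixpoint turn (R : realType) (q p : R * R) (s : seq (R * R)) : int :=
  if s is p' :: s' then half_turn (p - q) (p' - q) + turn q p' s' else 0.

Lemma turn_parity (R : realType) (q p : R * R) (s : seq (R * R)) :
  (turn q p s)%:~R = (up (last p s - q))%:R - (up (p - q))%:R :> 'F_2.
Proof.
elim: s p => [|p' s IH] p /=; first by rewrite subrr.
rewrite intrD IH /half_turn.
by case: (up (last _ _ - q)); case: (up (p - q)); case: (up (p' - q)) => //=;
  try (case: ifP => _); apply/eqP.
Qed.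

Definition apart (R : realType) (d : R) (s t : seq (R * R)) : bool :=
  all (fun p => all (fun q => ~~ near_pt (4 * d) p q) t) s.

Lemma turn_strip (R : realType) (d : R) (p p' q : R * R) (t : seq (R * R)) :
  0 < d -> near_pt d p p' -> path (near_pt d) q t -> apart d [:: p] (q :: t) ->
  half_turn (p - q) (p' - q) + turn p' q t =
  turn p q t + half_turn (p - last q t) (p' - last q t).
Proof.
move=> d0 pp'; elim: t q => [|q' t IH] q /=; first by rewrite addr0 add0r.
rewrite /apart /= andbT => /andP[qq' qt] /and3P[pq pq' pt].
have [l hl] := near_pt_half_plane pq.
have pp := near_ptxx p d0; have qq := near_ptxx q d0.
have flip x y z w : near_pt d p x -> near_pt d p y -> near_pt d q z -> near_pt d q w ->
    half_turn (z - x) (w - y) = half_turn (x - z) (y - w).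
  move=> *; rewrite -(opprB x z) -(opprB y w) half_turnN //.
    by apply: (@dot2_neq0 _ l); exact: hl.
  by apply: (@dot2_neq0 _ l); exact: hl.
rewrite (flip p p q q') // (flip p' p' q q') // -addrA -IH ?/apart /= ?andbT ?pq' //.
have h1 := half_turn_add (hl _ _ pp qq) (hl _ _ pp' qq) (hl _ _ pp' qq').
have h2 := half_turn_add (hl _ _ pp qq) (hl _ _ pp qq') (hl _ _ pp' qq').
by rewrite !addrA h1 h2.
Qed.

(** The segment from a point of one chain to a point of the other never degenerates, so
it turns by the same amount whichever end is moved first: the turn around each cell
of the grid of pairs is zero. *)
Lemma turn_grid (R : realType) (d : R) (p q : R * R) (s t : seq (R * R)) :
  0 < d -> path (near_pt d) p s -> path (near_pt d) q t ->
  apart d (p :: s) (q :: t) ->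
  turn q p s + turn (last p s) q t = turn p q t + turn (last q t) p s.
Proof.
move=> d0; elim: s p => [|p' s IH] p /=; first by rewrite addr0 add0r.
move=> /andP[pp' ps] qt /andP[pq st].
by rewrite -addrA IH // !addrA (turn_strip d0 pp' qt) // /apart /= pq.
Qed.

(** * Nonplanarity of the complete bipartite graph on 3 + 3 vertices *)

(** The relations of [turn_grid] between the chain from [a (k + 1)] to [b j] and the chain
from [a k] to [b l], summed over [k] and [j != l], contradict parity. *)
Lemma K33_chains (R : realType) (d : R) (a b : 'I_3 -> R * R)
    (c : 'I_3 -> 'I_3 -> seq (R * R)) :
  0 < d ->
  (forall i j, path (near_pt d) (a i) (c i j)) ->
  (forall i j, last (a i) (c i j) = b j) ->
  (forall i j k l, i != k -> j != l -> apart d (a i :: c i j) (a k :: c k l)) ->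
  False.
Proof.
move=> d0 cp cl far.
pose X i k l := turn (a i) (a k) (c k l); pose Y j k l := turn (b j) (a k) (c k l).
have rel i j k l : i != k -> j != l -> X i k l + Y l i j = X k i j + Y j k l.
  move=> ik jl; have := turn_grid d0 (cp k l) (cp i j) (far _ _ _ _ _ _).
  by rewrite !cl; apply; rewrite eq_sym.
have succ_neq (k : 'I_3) : k + 1 != k by rewrite -subr_eq0 addrC addrA addNr add0r.
have shift (V : zmodType) (f : 'I_3 -> V) : \sum_k f (k + 1) = \sum_k f k.
  by rewrite [RHS](reindex_inj (addIr 1)).
have sum2 (f : 'I_3 -> int) : \sum_l \sum_(j | j != l) f l = (\sum_l f l) *+ 2.
  rewrite -sumrMnl; apply: eq_bigr => l _.
  by rewrite sumr_const cardC1 card_ord.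
have swap (f : 'I_3 -> 'I_3 -> int) :
    \sum_l \sum_(j | j != l) f l j = \sum_l \sum_(j | j != l) f j l.
  rewrite (exchange_big_dep predT) //=; apply: eq_bigr => l _.
  by apply: eq_bigl => j; rewrite eq_sym.
(* the terms [Y] cancel; an [X] depends on one of [j != l] only, hence occurs twice *)
have XX : \sum_k \sum_l X (k + 1) k l = \sum_k \sum_l X k (k + 1) l.
  apply: (@pmulrnI int 2) => //; rewrite -!sumrMnl.
  under eq_bigr do rewrite -sum2.
  under [RHS]eq_bigr do rewrite -sum2 swap.
  apply: (addIr (\sum_k \sum_l \sum_(j | j != l) Y l (k + 1) j)).
  rewrite [X in _ = _ + X](shift _ (fun k => \sum_l \sum_(j | j != l) Y l k j)).
  under [X in _ = _ + X]eq_bigr do rewrite swap.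
  rewrite -!big_split /=; apply: eq_bigr => k _.
  rewrite -!big_split /=; apply: eq_bigr => l _.
  rewrite -!big_split /=; apply: eq_bigr => j jl.
  exact: rel.
have aa i k : i != k -> a i - a k != 0.
  move=> ik; apply/eqP => aik.
  have := far i 0 k 1 ik isT.
  rewrite /apart /= (_ : a i = a k) ?near_ptxx ?mulr_gt0 //.
  by apply/eqP; rewrite -subr_eq0 aik.
(* [a k - a (k + 1)] and its opposite lie in opposite half-planes: this is the [1] *)
have par k l : (X (k + 1) k l)%:~R - (X k (k + 1) l)%:~R
    = 1 + ((up (b l - a (k + 1)))%:R - (up (b l - a k))%:R) :> 'F_2.
  rewrite !turn_parity !cl -(opprB (a (k + 1)) (a k)) upN ?aa //.
  by case: (up (b l - a (k + 1))); case: (up (b l - a k)); case: (up (a (k + 1) - a k));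
    apply/eqP.
have : \sum_k \sum_l ((X (k + 1) k l)%:~R - (X k (k + 1) l)%:~R) = 0 :> 'F_2.
  under eq_bigr do rewrite sumrB -!rmorph_sum.
  by rewrite sumrB -!rmorph_sum XX subrr.
under eq_bigr do under eq_bigr do rewrite par.
under eq_bigr do rewrite big_split sumrB /=.
rewrite big_split sumrB /=.
rewrite (shift _ (fun k => \sum_l (up (b l - a k))%:R)) subrr addr0.
by rewrite !sumr_const !card_ord.
Qed.

(** The points reachable by steps shorter than [d] form a relatively clopen set. *)
Lemma connected_walk (R : realType) (M : set (R * R)) (d : R) (p q : R * R) :
  connected M -> 0 < d -> M p -> M q -> walk (near_pt d) M p q.
Proof.
move=> Mc d0 Mp Mq.
have nearE x y : near_pt d x y = `[< ball x d y >].
  by apply/andP/asboolP => -[].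
pose C := [set z | walk (near_pt d) M p z].
have CM : C `<=` M by move=> z [].
suff CE : C = M by have : C q by rewrite CE.
pose U (P : set (R * R)) := \bigcup_(z in P) (ball z d : set (R * R)).
have openU P : open (U P) by apply: bigcup_open => z _; exact: ball_open.
have subU P : P `<=` U P by move=> z Pz; exists z => //; exact: ballxx.
apply: Mc; first by exists p; apply: walk0.
  exists (U C) => //; apply/seteqP; split=> z.
    by move=> Cz; split; [exact: CM|exact: subU].
  by case=> Mz [y Cy yz]; apply: walkS Cy _ Mz; rewrite nearE; apply/asboolP.
exists (~` U (M `\` C)); first exact: open_closedC.
apply/seteqP; split=> z.
  move=> Cz; split; [exact: CM|move=> [y [My nCy] yz]; apply: nCy].
  by apply: walkS Cz _ My; rewrite near_ptC nearE; apply/asboolP.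
by case=> Mz nU; apply: contrapT => nC; apply: nU; exact: subU.
Qed.

(** The differences [p - q] form a compact set that does not contain the origin. *)
Lemma compact_disjoint_far (R : realType) (M N : set (R * R)) :
  compact M -> compact N -> M `&` N = set0 ->
  exists2 d, 0 < d & forall p q, M p -> N q -> ~~ near_pt d p q.
Proof.
move=> Mc Nc MN0.
pose f (z : (R * R) * (R * R)) := z.1 - z.2.
have fc : continuous f by move=> z; apply: cvgB; [exact: cvg_fst|exact: cvg_snd].
have /(compact_closed (@norm_hausdorff _ _)) Kc : compact (f @` (M `*` N)).
  apply: continuous_compact; last exact: compact_setX.
  exact: continuous_subspaceT.
have : nbhs (0 : R * R) (~` (f @` (M `*` N))).
  apply: open_nbhs_nbhs; split; first exact: closed_openC.
  case=> -[p q] [/= Mp Nq] /eqP; rewrite /f /= subr_eq0 => /eqP pq.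
  have : (M `&` N) p by split=> //; rewrite pq.
  by rewrite MN0.
case/nbhs_ballP => d /= d0 hd; exists d => // p q Mp Nq.
apply/negP => /andP[h1 h2]; apply: (hd (p - q)).
  by split; rewrite /ball /= sub0r normrN.
by exists (p, q).
Qed.

(** Fine chains inside the continua inherit the separation of independent continua. *)
Lemma K33_continua (R : realType) (a b : 'I_3 -> R * R) (M : 'I_3 -> 'I_3 -> set (R * R)) :
  (forall i j, [/\ compact (M i j), connected (M i j), M i j (a i) & M i j (b j)]) ->
  (forall i j k l, i != k -> j != l -> M i j `&` M k l = set0) ->
  False.
Proof.
move=> MP disj.
have /choice[D DP] (t : ('I_3 * 'I_3) * ('I_3 * 'I_3)) : exists d : R, 0 < d /\
    (t.1.1 != t.2.1 -> t.1.2 != t.2.2 ->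
     forall p q, M t.1.1 t.1.2 p -> M t.2.1 t.2.2 q -> ~~ near_pt d p q).
  case: t => [[i j] [k l]] /=.
  case: (boolP ((i != k) && (j != l))) => [/andP[ik jl]|/nandP nij].
    have [Mc _ _ _] := MP i j; have [Nc _ _ _] := MP k l.
    by have [d d0 hd] := compact_disjoint_far Mc Nc (disj _ _ _ _ ik jl); exists d.
  by exists 1; split=> // ik jl; case: nij; rewrite ?ik ?jl.
pose d := \big[Num.min/1]_t D t / 4.
have d0 : 0 < d.
  rewrite divr_gt0 //; apply/bigmin_gtP; split=> // t _.
  by case: (DP t).
have dD t : 4 * d <= D t by rewrite mulrC divfK ?bigmin_le.
have /choice[c cP] (t : 'I_3 * 'I_3) : exists s, [/\ path (near_pt d) (a t.1) s,
    last (a t.1) s = b t.2 & {in a t.1 :: s, forall z, M t.1 t.2 z}].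
  have [_ Mc Ma Mb] := MP t.1 t.2; exact: walk_path (connected_walk Mc d0 Ma Mb).
apply: (@K33_chains R d a b (fun i j => c (i, j))) => // [i j|i j|i j k l ik jl].
- by case: (cP (i, j)).
- by case: (cP (i, j)).
apply/allP => p pc; apply/allP => q qc.
have [_ _ /(_ p pc) /= Mp] := cP (i, j); have [_ _ /(_ q qc) /= Mq] := cP (k, l).
have [_ /(_ ik jl p q Mp Mq)] := DP ((i, j), (k, l)).
by apply: contra; exact/near_ptW/dD.
Qed.

Definition drawn (R : realType) (V : choiceType) (e : rel V) (pos : V -> R * R)
    (arc : V -> V -> R -> R * R) (W : set V) : set (R * R) :=
  [set p | (exists2 x, W x & p = pos x) \/
           exists x y t, [/\ W x, W y, e x y, t \in `]0, 1[ & p = arc x y t]].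

Lemma drawn_disjoint (R : realType) (V : choiceType) (e : rel V)
    (pos : V -> R * R) (arc : V -> V -> R -> R * R) (W W' : set V) :
  plane_drawing e pos arc -> W `&` W' = set0 ->
  drawn e pos arc W `&` drawn e pos arc W' = set0.
Proof.
move=> dr W0; have no x : W x -> W' x -> False.
  exact: setI0_absurd.
apply/seteqP; split=> // p [].
case=> [[x Wx ->]|[x [y [t [Wx Wy xy t01 ->]]]]].
  case=> [[x' W'x' /(drawing_pos_inj dr) xx']|[x' [y' [t [_ _ xy t01]]]]].
    by apply: (no x); rewrite // xx'.
  by move/esym/(drawing_arc_vertex dr xy t01).
case=> [[x' _]|[x' [y' [t' [W'x W'y xy' t01']]]]].
  by move/(drawing_arc_vertex dr xy t01).
apply: (drawing_arc_disjoint dr xy xy' _ _ t01 t01') => -[exx' eyy']; apply: (no x) => //.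
  by rewrite -exx'.
by rewrite -eyy'.
Qed.

Lemma drawn_edge (R : realType) (V : choiceType) (e : rel V)
    (pos : V -> R * R) (arc : V -> V -> R -> R * R) (W : set V) (x y : V) :
  plane_drawing e pos arc -> e x y -> W x -> W y ->
  arc x y @` `[0, 1] `<=` drawn e pos arc W.
Proof.
move=> dr xy Wx Wy _ [t /= t01 <-].
have [->|t0] := eqVneq t 0; first by left; exists x => //; exact: drawing_arc0 dr _ _ xy.
have [->|t1] := eqVneq t 1; first by left; exists y => //; exact: drawing_arc1 dr _ _ xy.
right; exists x, y, t; split=> //.
by move: t01; rewrite !in_itv /= !le_eqVlt (negbTE t1) eq_sym (negbTE t0).
Qed.

Lemma walk_continuum (R : realType) (V : choiceType) (e : rel V)
    (pos : V -> R * R) (arc : V -> V -> R -> R * R) (W : set V) (x y : V) :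
  plane_drawing e pos arc -> walk e W x y ->
  exists M, [/\ compact M, connected M, M (pos x), M (pos y) & M `<=` drawn e pos arc W].
Proof.
move=> dr; elim=> [Wx|y' z xy' [M [Mc Mk Mx My MW]] yz Wz].
  exists [set pos x]; split=> //; [exact: compact_set1|exact: connected1|].
  by move=> p ->; left; exists x.
have [_ Wy] := walk_mem xy'.
have ac := drawing_arc_cont dr yz.
have arc0 : (arc y' z @` `[0, 1]) (pos y').
  by exists 0; [rewrite /= in_itv /= lexx ler01|exact: drawing_arc0 dr _ _ yz].
exists (M `|` arc y' z @` `[0, 1]); split.
- by apply: compactU => //; apply: continuous_compact => //; exact: segment_compact.
- apply: connectedU => //; first by exists (pos y').
  by apply: connected_continuous_connected => //; exact: segment_connected.
- by left.
- by right; exists 1; [rewrite /= in_itv /= lexx ler01|exact: drawing_arc1 dr _ _ yz].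
- by rewrite subUset; split=> //; exact: drawn_edge.
Qed.

(** A walk from [a i] to [b j] inside [A i `|` B j] is drawn as a continuum; for
[i != k] and [j != l] the sets [A i `|` B j] and [A k `|` B l] are disjoint, hence so
are the drawings. The walks need not be disjoint in any stronger sense, because
[K33_continua] constrains independent pairs only. *)
Lemma planar_no_K33 (R : realType) (V : choiceType) (e : rel V) (A B : 'I_3 -> set V) :
  planar R e -> symmetric e ->
  (forall i, walk_connected e (A i)) -> (forall j, walk_connected e (B j)) ->
  (forall i k, i != k -> A i `&` A k = set0) ->
  (forall j l, j != l -> B j `&` B l = set0) ->
  (forall i j, A i `&` B j = set0) ->
  (forall i j, exists x y, [/\ A i x, B j y & e x y]) ->
  False.
Proof.
move=> [pos [arc dr]] es Ac Bc AA BB AB adj.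
have /choice[a aP] i : exists x, A i x by have [x [y []]] := adj i 0; exists x.
have /choice[b bP] j : exists y, B j y by have [x [y []]] := adj 0 j; exists y.
have link (t : 'I_3 * 'I_3) : walk e (A t.1 `|` B t.2) (a t.1) (b t.2).
  have [x [y [Ax By xy]]] := adj t.1 t.2.
  apply: (@walk_trans _ _ _ x); first by apply: walkW (Ac _ _ _ (aP _) Ax); left.
  apply: (@walk_trans _ _ _ y); last by apply: walkW (Bc _ _ _ By (bP _)); right.
  by apply: walk1 => //; [left|right].
have /choice[M MP] t := walk_continuum dr (link t).
apply: (@K33_continua R (pos \o a) (pos \o b) (fun i j => M (i, j))).
  by move=> i j; case: (MP (i, j)).
move=> i j k l ik jl; apply/seteqP; split=> // p [Mp Mp'].
have [_ _ _ _ /(_ _ Mp) /= d1] := MP (i, j).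
have [_ _ _ _ /(_ _ Mp') /= d2] := MP (k, l).
apply: (setI0_absurd (drawn_disjoint dr _) d1 d2).
apply/seteqP; split=> // x [] [h|h] [h'|h'].
- exact: setI0_absurd (AA _ _ ik) h h'.
- exact: setI0_absurd (AB i l) h h'.
- exact: setI0_absurd (AB k j) h' h.
- exact: setI0_absurd (BB _ _ jl) h h'.
Qed.

(** * Menger's theorem *)

Definition edges_rel (T : eqType) (E : seq (T * T)) : rel T := fun x y => (x, y) \in E.

Definition separates (T : eqType) (E : seq (T * T)) (A B : set T) (X : seq T) : Prop :=
  forall a b, A a -> B b -> ~ walk (edges_rel E) (~` [set` X]) a b.

(** Disjoint paths, each recorded as a set of vertices supporting a walk. *)
Definition linkage (T : eqType) (E : seq (T * T)) (A B : set T) (k : nat) : Prop :=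
  exists (D : 'I_k -> set T) (a b : 'I_k -> T),
    (forall i j, i != j -> D i `&` D j = set0) /\
    (forall i, [/\ A (a i), B (b i) & walk (edges_rel E) (D i) (a i) (b i)]).

Lemma set_bounded_or_inj (T : eqType) (Z : set T) (k : nat) :
  (exists2 X : seq T, (size X < k)%N & Z `<=` [set` X]) \/
  (exists f : 'I_k -> T, injective f /\ forall i, Z (f i)).
Proof.
have [[X [Xk ZX]]|far] := pselect (exists X : seq T, (size X < k)%N /\ Z `<=` [set` X]).
  by left; exists X.
right; have [s [us sk sZ]] : exists s : seq T, [/\ uniq s, size s = k & {in s, forall z, Z z}].
  have : (k <= k)%N by []; elim: {1 3}k => [|m IH] mk; first by exists [::].
  have [s [us sm sZ]] := IH (ltnW mk).
  have /existsNP[z /not_implyP[Zz /negP zs]] : ~ Z `<=` [set` s].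
    by move=> Zs; apply: far; exists s; rewrite sm.
  exists (z :: s); rewrite /= zs us sm; split=> // w.
  by rewrite inE => /orP[/eqP->|/sZ].
rewrite -sk; exists (tnth (in_tuple s)); split; first exact/tuple_uniqP.
by move=> i; apply: sZ; exact: mem_tnth.
Qed.

Section Menger.
Variables (T : eqType).
Implicit Types (E : seq (T * T)) (A B : set T).

Lemma cover_of_inj (k : nat) (f : 'I_k -> T) (P : seq T) :
  injective f -> (forall i, f i \in P) -> (size P <= k)%N ->
  uniq P /\ forall z, z \in P -> exists i, f i = z.
Proof.
move=> fi fP Pk.
have us : uniq (codom f) by rewrite map_inj_uniq ?enum_uniq.
have sub : {subset codom f <= P} by move=> _ /codomP[i ->].
have sz : (size P <= size (codom f))%N by rewrite size_codom card_ord.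
have [eqsz eqm] := uniq_min_size us sub sz.
split; first by rewrite -(eq_uniq eqsz eqm).
by move=> z; rewrite -eqm => /codomP[i ->]; exists i.
Qed.

Lemma edges_rel_cons E x y u v :
  edges_rel ((x, y) :: E) u v -> (u = x /\ v = y) \/ edges_rel E u v.
Proof. by rewrite /edges_rel inE => /orP[/eqP[-> ->]|]; [left|right]. Qed.

Lemma edges_rel_consr E p : subrel (edges_rel E) (edges_rel (p :: E)).
Proof. by move=> u v; rewrite /edges_rel inE => ->; rewrite orbT. Qed.

(** A walk from [A] that has not yet met [x :: S] has not used the new edge, which
leaves from [x]; if it avoids [X] it thus never meets [x :: S], contradicting that [S]
separates without the new edge. *)
Lemma separates_from E A B x y (X S : seq T) :
  separates E A B S -> separates E A [set` x :: S] X ->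
  separates ((x, y) :: E) A B X.
Proof.
move=> sepS sepX a b Aa Bb w; apply: (sepS a b) => //.
suff H : forall z, walk (edges_rel ((x, y) :: E)) (~` [set` X]) a z ->
    walk (edges_rel E) (~` [set` X] `&` ~` [set` x :: S]) a z.
  apply: walkW (H _ w) => u [_ /=] nu uS; apply: nu.
  by rewrite inE uS orbT.
have step z' z : walk (edges_rel E) (~` [set` X] `&` ~` [set` x :: S]) a z' ->
    edges_rel E z' z -> ~ z \in X -> ~ z \in x :: S.
  move=> w' e' zX zP; apply: (sepX a z) => //; apply: walkS e' zX.
  by apply: walkW w' => ? [].
move=> z; elim=> [aX|z' {}z _ w' /edges_rel_cons zz zX].
  by apply: walk0; split=> // aP; apply: (sepX a a) => //; exact: walk0.
have [_ [_ z'P]] := walk_mem w'.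
case: zz => [[z'x _]|zz]; first by case: z'P; rewrite /= z'x mem_head.
by apply: (walkS w' zz); split=> //; exact: step w' zz zX.
Qed.

(** After its last use of the new edge or its last visit to [S], a walk to [B] starts
in [y :: S] and uses old edges only. *)
Lemma separates_to E A B x y (X S : seq T) :
  separates E A B S -> separates E [set` y :: S] B X ->
  separates ((x, y) :: E) A B X.
Proof.
move=> sepS sepX a b Aa Bb w.
suff [w'|[q Qq w']] : walk (edges_rel E) (~` [set` S]) a b \/
    exists2 q, q \in y :: S & walk (edges_rel E) (~` [set` X]) q b.
- exact: sepS w'.
- exact: sepX w'.
clear Bb; elim: w => [aX|z' z _ IH /edges_rel_cons zz zX].
  have [aS|/negP aS] := boolP (a \in S); last by left; apply: walk0.
  by right; exists a; rewrite ?inE ?aS ?orbT //; exact: walk0.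
case: zz => [[_ zy]|zz].
  by right; exists z; rewrite ?inE ?zy ?eqxx //; apply: walk0; rewrite -zy.
case: IH => [w'|[q Qq w']]; last by right; exists q => //; apply: walkS zz zX.
have [zS|/negP zS] := boolP (z \in S); last by left; apply: walkS zz zS.
by right; exists z; rewrite ?inE ?zS ?orbT //; exact: walk0.
Qed.

(** Since the sets [x :: S] and [y :: S] have at most [k] elements, every one of their
elements is on exactly one path. Paths into [x :: S] and paths out of [y :: S] meet
only in [S], as [S] separates, so they can be glued along [S] and along the new edge
from [x] to [y]. *)
Lemma linkage_join E A B x y (S : seq T) (k : nat) :
  (size S < k)%N -> separates E A B S ->
  linkage E A [set` x :: S] k -> linkage E [set` y :: S] B k ->
  linkage ((x, y) :: E) A B k.
Proof.
move=> Sk sepS [D [a [p [Ddisj DP]]]] [D' [q [b [Ddisj' DP']]]].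
have inj_of (C : 'I_k -> set T) (f : 'I_k -> T) :
    (forall i j, i != j -> C i `&` C j = set0) -> (forall i, C i (f i)) ->
    forall i j, C i (f j) -> i = j.
  move=> Cd Cf i j Cij; apply/eqP; apply: contraT => ij.
  by case: (setI0_absurd (Cd _ _ ij) Cij (Cf j)).
have pD : forall i, D i (p i) by move=> i; have [_ _ w] := DP i; have [] := walk_mem w.
have qD : forall i, D' i (q i) by move=> i; have [_ _ w] := DP' i; have [] := walk_mem w.
have pI := inj_of _ _ Ddisj pD; have qI := inj_of _ _ Ddisj' qD.
have pinj : injective p by move=> i j pij; apply: pI; rewrite -pij.
have qinj : injective q by move=> i j qij; apply: qI; rewrite -qij.
have [uP surP] := cover_of_inj pinj (fun i => let: And3 _ h _ := DP i in h) Sk.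
have [uQ surQ] := cover_of_inj qinj (fun i => let: And3 h _ _ := DP' i in h) Sk.
have xS : x \notin S by case/andP: uP.
have yS : y \notin S by case/andP: uQ.
have DPeq i z : D i z -> z \in x :: S -> z = p i.
  by move=> Dz /surP[j zj]; rewrite -zj; congr p; apply/esym/pI; rewrite zj.
have DQeq i z : D' i z -> z \in y :: S -> z = q i.
  by move=> Dz /surQ[j zj]; rewrite -zj; congr q; apply/esym/qI; rewrite zj.
pose phi z := if z == x then y else z.
have /choice[s sP] i : exists j, q j = phi (p i).
  have [_ pP _] := DP i; apply: surQ; move: pP; rewrite /= /phi !inE.
  by case: eqP => [_|_ /= ->]; rewrite ?eqxx ?orbT.
have sinj : injective s.
  move=> i j sij; apply: pinj; have := sP i; rewrite sij sP /phi.
  have [_ pi _] := DP i; have [_ pj _] := DP j.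
  move: pi pj; rewrite /= !inE; case: eqP => [->|_]; case: eqP => [->|_] //=.
    by move=> _ pjS e; case/negP: yS; rewrite -e.
  by move=> piS _ e; case/negP: yS; rewrite e.
pose C i := [set z | walk (edges_rel E) (D i `\ p i) (a i) z] `|` [set p i].
pose C' j := [set z | walk (edges_rel E) (D' j `\ q j) z (b j)] `|` [set q j].
have Cw i : walk (edges_rel E) (C i) (a i) (p i) by apply: walk_first; case: (DP i).
have Cw' i : walk (edges_rel E) (C' i) (q i) (b i) by apply: walk_last; case: (DP' i).
have CD i z : C i z -> D i z by case=> [w|->//]; have [_ []] := walk_mem w.
have CD' i z : C' i z -> D' i z by case=> [w|->//]; have [[]] := walk_mem w.
(* the part of a trimmed walk before a point off S avoids S *)
have before i z : C i z -> z \notin S -> walk (edges_rel E) (~` [set` S]) (a i) z.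
  have off w : (D i `\ p i) w -> (~` [set` S]) w.
    by case=> Dw wp wS; apply: wp; apply: DPeq => //; rewrite inE wS orbT.
  case=> [w _|->]; first exact: walkW w.
  move=> pS; apply: walkW (Cw i) => w [h|->]; last exact/negP.
  by have [_] := walk_mem h; exact: off.
have after i z : C' i z -> z \notin S -> walk (edges_rel E) (~` [set` S]) z (b i).
  have off w : (D' i `\ q i) w -> (~` [set` S]) w.
    by case=> Dw wp wS; apply: wp; apply: DQeq => //; rewrite inE wS orbT.
  case=> [w _|->]; first exact: walkW w.
  move=> pS; apply: walkW (Cw' i) => w [h|->]; last exact/negP.
  by have [+ _] := walk_mem h; exact: off.
have meet i j z : C i z -> C' j z -> j = s i.
  move=> Cz Cz'; have [zS|zS] := boolP (z \in S); last first.
    have [Aa _ _] := DP i; have [_ Bb _] := DP' j.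
    case: (sepS _ _ Aa Bb); apply: walk_trans (before _ _ Cz zS) (after _ _ Cz' zS).
  have zp : z = p i by apply: DPeq; [exact: CD|rewrite inE zS orbT].
  have zq : z = q j by apply: DQeq; [exact: CD'|rewrite inE zS orbT].
  apply: qinj; rewrite sP -zp -zq /phi; case: eqP => // zx.
  by case/negP: xS; rewrite -zx.
exists (fun i => C i `|` C' (s i)), a, (b \o s); split.
  move=> i j ij; apply/seteqP; split=> // z [].
  move=> [h|h] [h'|h'].
  - exact: setI0_absurd (Ddisj _ _ ij) (CD _ _ h) (CD _ _ h').
  - by case/eqP: ij; apply: sinj; rewrite (meet _ _ _ h h').
  - by case/eqP: ij; apply: sinj; rewrite (meet _ _ _ h' h).
  - by apply: setI0_absurd (Ddisj' _ _ _) (CD' _ _ h) (CD' _ _ h'); rewrite (inj_eq sinj).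
move=> i; have [Aa pP _] := DP i; have [qQ Bb _] := DP' (s i); split=> //.
have EE := @edges_rel_consr E (x, y).
have w1 : walk (edges_rel ((x, y) :: E)) (C i `|` C' (s i)) (a i) (p i).
  by apply: walk_sub (Cw i) => [u v _ _|]; [exact: EE|left].
have w2 : walk (edges_rel ((x, y) :: E)) (C i `|` C' (s i)) (q (s i)) (b (s i)).
  by apply: walk_sub (Cw' (s i)) => [u v _ _|]; [exact: EE|right].
apply: walk_trans w1 _; have := sP i; rewrite /phi; case: eqP => [px qy|_ <- //].
apply: walk_trans w2; apply: walk1; [by left; right|by right; right|].
by rewrite px qy /edges_rel mem_head.
Qed.

(** Induction on the edges. If [S] separates [A] from [B] once the edge from [x] to [y]
is deleted, then both [x :: S] and [y :: S] separate, and the induction hypothesis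
links them to [A] and to [B]. *)
Theorem menger E A B (k : nat) :
  (exists2 X : seq T, (size X < k)%N & separates E A B X) \/ linkage E A B k.
Proof.
elim: E A B => [|[x y] E IH] A B.
  have [[X Xk ABX]|[f [fi fAB]]] := set_bounded_or_inj (A `&` B) k.
    left; exists X => // a b Aa Bb w.
    suff ab : b = a.
      by case: (walk_mem w) => aX _; apply: aX; apply: ABX; split; rewrite // -ab.
    by case: w.
  right; exists (fun i => [set f i]), f, f; split.
    move=> i j ij; apply/seteqP; split=> // z [-> /fi ij'].
    by rewrite ij' eqxx in ij.
  by move=> i; have [Af Bf] := fAB i; split=> //; exact: walk0.
have [[S Sk sepS]|[D [a [b [Dd DP]]]]] := IH A B; last first.
  right; exists D, a, b; split=> // i; have [Aa Bb w] := DP i; split=> //.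
  by apply: walk_sub w => // u v _ _; exact: edges_rel_consr.
have [[X Xk sepX]|l1] := IH A [set` x :: S].
  by left; exists X => //; exact: separates_from sepS sepX.
have [[X Xk sepX]|l2] := IH [set` y :: S] B.
  by left; exists X => //; exact: separates_to sepS sepX.
by right; exact: linkage_join Sk sepS l1 l2.
Qed.

End Menger.

(** * Balls, doubling and nets *)

Section GraphBalls.
Variables (V : choiceType) (e : rel V).

Lemma gball0 (a : V) (n : nat) : gball e a n a.
Proof. by exists [::]. Qed.

Lemma gball_le (a : V) (m n : nat) : (m <= n)%N -> gball e a m `<=` gball e a n.
Proof. by move=> mn y [p [? ? pm]]; exists p; split=> //; exact: leq_trans pm mn. Qed.

Lemma gball_step (a : V) (n : nat) (y z : V) : gball e a n y -> e y z -> gball e a n.+1 z.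
Proof.
move=> [p [ep ly pn]] yz; exists (rcons p z).
by rewrite rcons_path last_rcons size_rcons ep ly.
Qed.

Lemma gball_inv (a : V) (n : nat) (z : V) : gball e a n.+1 z ->
  gball e a n z \/ exists2 y, gball e a n y & e y z.
Proof.
move=> [p]; case/lastP: p => [|p w] [+ +].
  by move=> _ /= <- _; left; exact: gball0.
rewrite rcons_path last_rcons size_rcons => /andP[ep ew] <- pn.
by right; exists (last a p) => //; exists p.
Qed.

Lemma gball_trans (a b c : V) (m n : nat) :
  gball e a m b -> gball e b n c -> gball e a (m + n) c.
Proof.
move=> [p [ep lp pm]] [q [eq lq qn]]; exists (p ++ q).
by rewrite cat_path last_cat size_cat lp ep leq_add.
Qed.

Lemma gball_sym (a b : V) (n : nat) : symmetric e -> gball e a n b -> gball e b n a.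
Proof.
move=> es [p [ep lp pn]]; exists (rev (belast a p)).
rewrite size_rev size_belast; split=> //.
  by rewrite -lp rev_path; under eq_path => x y do rewrite /= es.
by case: p {pn ep} lp => [//|x p] _; rewrite /= rev_cons last_rcons.
Qed.

Lemma gball_walk (a : V) (n : nat) (y : V) : gball e a n y -> walk e (gball e a n) a y.
Proof.
elim: n y => [|n IH] y ay.
  case: ay => p [_ <- ]; rewrite leqn0 size_eq0 => /eqP-> /=.
  by apply: walk0; exact: gball0.
have sub := gball_le (leqnSn n).
case: (gball_inv ay) => [/IH|[z /IH az zy]]; first exact: walkW.
by apply: walkS zy ay; exact: walkW az.
Qed.

Lemma finite_gball (a : V) (n : nat) : locally_finite e -> finite_set (gball e a n).
Proof.
move=> lf; elim: n => [|n IH].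
  apply: (sub_finite_set _ (finite_set1 a)) => y [p [_ <-]].
  by rewrite leqn0 size_eq0 => /eqP->.
apply: (@sub_finite_set _ _ (gball e a n `|` \bigcup_(y in gball e a n) [set z | e y z])).
  by move=> z /gball_inv[|[y ay yz]]; [left|right; exists y].
by rewrite finite_setU; split=> //; apply: bigcup_finite => // y _; exact: lf.
Qed.

Lemma volume_gt0 (a : V) (n : nat) : locally_finite e -> (0 < volume e a n)%N.
Proof.
move=> lf; rewrite /volume /nb_vertices cardfs_gt0; apply/fset0Pn; exists a.
by rewrite in_fset_set ?inE; [exact: gball0|exact: finite_gball].
Qed.

End GraphBalls.

Definition restrict (V : choiceType) (e : rel V) (U : set V) : rel V :=
  fun x y => [&& x \in U, y \in U & e x y].

Lemma restrict_sym (V : choiceType) (e : rel V) (U : set V) :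
  symmetric e -> symmetric (restrict e U).
Proof. by move=> es x y; rewrite /restrict es andbCA. Qed.

Lemma gball_restrict (V : choiceType) (e : rel V) (U : set V) (a b : V) (n : nat) :
  gball e a n `<=` U -> gball e a n b -> gball (restrict e U) a n b.
Proof.
elim: n b => [|n IH] b sub ab.
  by case: ab => p [_ <-]; rewrite leqn0 size_eq0 => /eqP->; exact: gball0.
have sub' : gball e a n `<=` U by move=> z /(gball_le (leqnSn n))/sub.
case: (gball_inv ab) => [/(IH _ sub')|[c ac cb]]; first exact: gball_le.
apply: gball_step (IH _ sub' ac) _.
by rewrite /restrict cb !mem_set //; [exact: sub|exact: sub'].
Qed.

Lemma doubling_volume (R : realType) (V : choiceType) (e : rel V) :
  doubling R e -> exists M : nat, forall a b n, (0 < n)%N ->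
    (volume e a (8 * n) <= M * volume e b n)%N.
Proof.
move=> [C C0 CP]; exists (Num.bound (C ^+ 3)) => a b n n0.
rewrite -(ler_nat R) natrM.
apply: (@le_trans _ _ (C ^+ 3 * (volume e b n)%:R)); last first.
  by rewrite ler_wpM2r // ltW // archi_boundP // exprn_ge0 // ltW.
rewrite exprS -mulrA (_ : 8 * n = 2 * (4 * n))%N; last by rewrite mulnA.
apply: le_trans (CP a a _ _) _; first by rewrite muln_gt0.
rewrite ler_wpM2l ?(ltW C0) // exprS -mulrA expr1.
rewrite (_ : 4 * n = 2 * (2 * n))%N; last by rewrite mulnA.
apply: le_trans (CP a a _ _) _; first by rewrite muln_gt0.
by rewrite ler_wpM2l ?(ltW C0) // CP.
Qed.

Lemma sum_card_disjoint (V : choiceType) (f : V -> {fset V}) (A : {fset V}) (s : seq V) :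
  uniq s -> {in s &, forall x y, x != y -> [disjoint f x & f y]%fset} ->
  {in s, forall x, f x `<=` A}%fset ->
  (\sum_(x <- s) #|` f x| <= #|` A|)%N.
Proof.
elim: s A => [|x s IH] A; first by rewrite big_nil.
move=> /= /andP[xs us] dis sub; rewrite big_cons.
have fxA : (f x `<=` A)%fset by apply: sub; rewrite mem_head.
rewrite -(cardfsID (f x) A) (fsetIidPr fxA) leq_add2l.
apply: IH => // [y z ys zs|y ys]; first by apply: dis; rewrite inE ?ys ?zs orbT.
rewrite fsubsetD sub ?inE ?ys ?orbT //= fdisjoint_sym; apply: dis.
- by rewrite mem_head.
- by rewrite inE ys orbT.
- by apply: contraNneq xs => ->.
Qed.

Definition balls_meet (V : choiceType) (e : rel V) (n : nat) (x y : V) : Prop :=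
  exists2 w, gball e x n w & gball e y n w.

Lemma balls_meet_walk (V : choiceType) (e : rel V) (v x y : V) (m n : nat) :
  symmetric e -> balls_meet e n x y ->
  ~ gball e v (m + n) x -> ~ gball e v (m + n) y -> walk e (~` gball e v m) x y.
Proof.
move=> es [w xw yw] xfar yfar.
have out z : ~ gball e v (m + n) z -> gball e z n `<=` ~` gball e v m.
  by move=> zfar u zu vu; apply: zfar; apply: gball_trans vu (gball_sym es zu).
apply: (@walk_trans _ _ _ w); first by apply: walkW (out _ xfar) _; exact: gball_walk.
by apply: walk_sym => //; apply: walkW (out _ yfar) _; exact: gball_walk.
Qed.

(** The centres are those of a largest family of disjoint balls of radius [n]; there are
at most [M], since these balls lie in [gball e v (8 * n)]. *)
Lemma net (V : choiceType) (e : rel V) (M : nat) (v : V) (n : nat) (Z : set V) :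
  locally_finite e -> (0 < n)%N ->
  (forall a b, volume e a (8 * n) <= M * volume e b n)%N ->
  Z `<=` gball e v (7 * n) ->
  exists s : seq V, [/\ (size s <= M)%N, {in s, forall y, Z y} &
    forall z, Z z -> exists2 y, y \in s & balls_meet e n y z].
Proof.
move=> lf n0 VM ZB.
pose sep s := [/\ uniq s, {in s, forall y, Z y} &
  {in s &, forall x y, x != y -> ~ balls_meet e n x y}].
have sepM s : sep s -> (size s <= M)%N.
  move=> [us sZ sd]; rewrite -(leq_pmul2r (volume_gt0 v (8 * n) lf)).
  apply: (@leq_trans (\sum_(y <- s) M * volume e y n)).
    rewrite -sum1_size big_distrl /=; apply: leq_sum => y _; rewrite mul1n; exact: VM.
  rewrite -big_distrr leq_mul2l; apply/orP; right.
  apply: sum_card_disjoint => // [x y xs ys xy|x xs].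
    apply/fdisjointP => w; rewrite !in_fset_set ?inE; try exact: finite_gball.
    by move=> xw; apply/negP; rewrite inE => yw; apply: (sd x y xs ys xy); exists w.
  rewrite -fset_set_sub; try exact: finite_gball.
  move=> w xw; rewrite (_ : 8 * n = 7 * n + n)%N; last by rewrite -mulSnr.
  by apply: gball_trans xw; apply: ZB; exact: sZ.
pose P k := `[< exists s, sep s /\ size s = k >].
have P0 : exists k, P k by exists 0%N; apply/asboolP; exists [::].
have PM k : P k -> (k <= M)%N by move=> /asboolP[s [/sepM + <-]].
case: (ex_maxnP P0 PM) => k /asboolP[s [ss sk]] kmax.
exists s; split; [exact: sepM|by case: ss|move=> z Zz].
apply: contrapT => far.
have zs : z \notin s.
  apply/negP => zs; apply: far; exists z => //; exists z; exact: gball0.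
suff : P k.+1 by move=> /kmax; rewrite ltnn.
apply/asboolP; exists (z :: s); rewrite /= sk; split=> //.
have [us sZ sd] := ss; split=> /=; first by rewrite zs us.
  by move=> y; rewrite inE => /orP[/eqP->|/sZ].
move=> x y; rewrite !inE => /orP[/eqP->|xs] /orP[/eqP->|ys].
- by rewrite eqxx.
- by move=> _ [w zw yw]; apply: far; exists y => //; exists w.
- by move=> _ zx; apply: far; exists x.
- exact: sd.
Qed.

(** * Disjoint paths across an annulus *)

Section Growth.
Variables (R : realType) (V : choiceType) (e : rel V).
Hypotheses (e_planar : planar R e) (e_sym : symmetric e).
Variables (A K : set V) (m : nat) (P : 'I_m -> set V).
Hypotheses (Ac : walk_connected e A) (Kc : walk_connected e K) (AK : A `&` K = set0).
Hypotheses (Pc : forall i, walk_connected e (P i))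
  (PP : forall i j, i != j -> P i `&` P j = set0)
  (PA : forall i, P i `&` A = set0) (PK : forall i, P i `&` K = set0)
  (PeA : forall i, exists x y, [/\ P i x, A y & e x y])
  (PeK : forall i, exists x y, [/\ P i x, K y & e x y]).

Definition met (Q : set V) : {set 'I_m} := [set i | `[< P i `&` Q !=set0 >]].

Lemma metP (Q : set V) (i : 'I_m) : reflect (P i `&` Q !=set0) (i \in met Q).
Proof. by rewrite inE; exact: asboolP. Qed.

(** Three paths of [N] would form a [K_{3,3}] minor with [A], [K] and [Q]. *)
Lemma no_tripod (Q : set V) (N : {set 'I_m}) :
  walk_connected e Q -> Q `&` A = set0 -> Q `&` K = set0 ->
  (forall i, i \in N -> P i `&` Q = set0 /\ exists x y, [/\ P i x, Q y & e x y]) ->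
  (#|N| <= 2)%N.
Proof.
move=> Qc QA QK NP; rewrite leqNgt; apply/negP => /card_gt2P[a [b [c [[aN bN cN] [ab bc ca]]]]].
pose t := [tuple a; b; c].
have tN i : tnth t i \in N.
  by have := mem_tnth i t; rewrite !inE => /or3P[] /eqP->.
have tI i k : i != k -> tnth t i != tnth t k.
  apply: contraNneq => /(tuple_uniqP _ _) ->//.
  by rewrite /= !inE negb_or ab bc eq_sym ca.
pose B (j : 'I_3) := nth set0 [:: A; K; Q] j.
apply: (@planar_no_K33 R V e (fun i => P (tnth t i)) B) => //.
- by move=> [[|[|[|]]]].
- by move=> i k ik; apply: PP; exact: tI.
- by move=> [[|[|[|j]]] jl] [[|[|[|l]]] ll] //= _; rewrite /B //= setIC.
- move=> i [[|[|[|j]]] jl]; rewrite /B //=.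
  by case: (NP _ (tN i)).
- move=> i [[|[|[|j]]] jl]; rewrite /B //=.
  by case: (NP _ (tN i)).
Qed.

(** [Q] is enlarged by its neighbours off [A `|` K] and by every path that they touch;
being disjoint from the paths not yet met, [Q] is adjacent to those met next, so
[no_tripod] allows at most two of them at each step. *)
Lemma saturated_growth (j : 'I_m) (y : V) (k : nat) : P j y ->
  exists Q, [/\ walk_connected e Q, Q `&` A = set0, Q `&` K = set0 &
   [/\ forall i, i \in met Q -> P i `<=` Q,
       gball (restrict e (~` (A `|` K))) y k `<=` Q &
       (#|met Q| <= (2 * k).+1)%N]].
Proof.
move=> Pjy.
have Peq i i' x : P i x -> P i' x -> i = i'.
  move=> ix jx; apply/eqP; apply: contraT => ij.
  by case: (setI0_absurd (PP ij) ix jx).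
elim: k => [|k [Q [Qc QA QK [Qs Qb Qm]]]].
  exists (P j); split=> //; split.
  - by move=> i /metP[x [ix jx]]; rewrite (Peq i j x).
  - by move=> x [p [_ <-]]; rewrite leqn0 size_eq0 => /eqP->.
  - rewrite muln0 -(cards1 j); apply: subset_leq_card.
    apply/fintype.subsetP => i /metP[x [ix jx]].
    by rewrite inE (Peq i j x).
pose U := ~` (A `|` K).
pose N := [set z | U z /\ exists2 x, Q x & e x z].
pose X := Q `|` N.
pose Q' := X `|` \bigcup_(i in [set i | i \in met X]) P i.
have XQ' : X `<=` Q' by move=> z; left.
have PQ' i : i \in met X -> P i `<=` Q' by move=> iX z iz; right; exists i.
have Qy : Q y by apply: Qb; exact: gball0.
have walkX z : X z -> walk e Q' y z.
  have QQ' : Q `<=` Q' by move=> ? ?; apply: XQ'; left.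
  case=> [Qz|Nz]; first exact: walkW (Qc _ _ Qy Qz).
  have [_ [x Qx xz]] := Nz.
  by apply: (walkS (walkW QQ' (Qc _ _ Qy Qx)) xz); apply: XQ'; right.
have Q'U z : Q' z -> ~ (A `|` K) z.
  case=> [[Qz|[]//]|[i _ iz]] [h|h].
  - exact: setI0_absurd QA Qz h.
  - exact: setI0_absurd QK Qz h.
  - exact: setI0_absurd (PA i) iz h.
  - exact: setI0_absurd (PK i) iz h.
have metQ' i : i \in met Q' -> i \in met X.
  move=> /metP[x [ix [Xx|[i' iX' ix']]]]; first by apply/metP; exists x.
  by rewrite (Peq i i' x).
exists Q'; split.
- apply: (@walk_connected_from _ _ _ y e_sym) => z [/walkX //|[i iX iz]].
  have /metP[w [iw Xw]] := iX.
  apply: walk_trans (walkX _ Xw) _.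
  by apply: walkW (Pc iw iz); exact: PQ'.
- by apply/seteqP; split=> // z [/Q'U h Az]; apply: h; left.
- by apply/seteqP; split=> // z [/Q'U h Az]; apply: h; right.
split.
- by move=> i /metQ'/PQ'.
- move=> z /gball_inv[/Qb Qz|[x /Qb Qx /and3P[xU zU xz]]]; first by left; left.
  by left; right; split; [move: zU; rewrite inE|exists x].
- have sub : met Q' \subset met Q :|: (met N :\: met Q).
    apply/fintype.subsetP => i /metQ'/metP[x [ix Xx]].
    rewrite finset.in_setU finset.in_setD; case: (boolP (i \in met Q)) => //= iQ.
    case: Xx => [Qx|Nx]; last by apply/metP; exists x.
    by case/metP: iQ; exists x.
  apply: leq_trans (subset_leq_card sub) _; apply: leq_trans (leq_card_setU _ _) _.
  rewrite (_ : (2 * k.+1).+1 = (2 * k).+1 + 2)%N; last by lia.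
  apply: leq_add => //; apply: (no_tripod Qc QA QK) => i.
  rewrite finset.in_setD => /andP[iQ /metP[x [ix [_ [w Qw wx]]]]].
  split; last by exists x, w; rewrite e_sym.
  by apply/seteqP; split=> // z [iz Qz]; case/metP: iQ; exists z.
Qed.

End Growth.

Lemma card_le_cover (T : finType) (V : eqType) (r : V -> pred T) (s : seq V)
    (A : {set T}) (b : nat) :
  (forall i, i \in A -> has (fun y => r y i) s) ->
  {in s, forall y, #|r y| <= b}%N -> (#|A| <= size s * b)%N.
Proof.
elim: s A => [|y s IH] A cov sb.
  by rewrite leqn0 cards_eq0; apply/set0Pn => -[i /cov].
rewrite mulSn -(cardsID [set i | r y i] A); apply: leq_add.
  apply: leq_trans (sb y (mem_head _ _)).
  by apply: subset_leq_card; apply/fintype.subsetP => i; rewrite !inE => /andP[].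
apply: IH => [i|z zs]; last by apply: sb; rewrite inE zs orbT.
by rewrite finset.in_setD inE => /andP[/negbTE yi /cov /=]; rewrite yi.
Qed.

(** Each path has a point [z i] on the sphere of radius [3 * n], and the balls of radius
[n] around such points stay clear of the inner ball and of [K]. So if the balls around
[z i] and a centre meet, [2 * n] steps off both sets lead from the centre to [z i], and
[saturated_growth] bounds the number of such [i]. *)
Lemma crossing_bound (R : realType) (V : choiceType) (e : rel V) (M : nat)
    (v : V) (n : nat) (K : set V) (m : nat) (P : 'I_m -> set V) :
  planar R e -> symmetric e -> locally_finite e -> (0 < n)%N ->
  (forall a b, volume e a (8 * n) <= M * volume e b n)%N ->
  walk_connected e K -> K `<=` ~` gball e v (5 * n) ->
  (forall i, walk_connected e (P i)) ->
  (forall i j, i != j -> P i `&` P j = set0) ->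
  (forall i, P i `&` gball e v n = set0) -> (forall i, P i `&` K = set0) ->
  (forall i, exists x y, [/\ P i x, gball e v n y & e x y]) ->
  (forall i, exists x y, [/\ P i x, K y & e x y]) ->
  (forall i, exists z, [/\ P i z, gball e v (3 * n) z & ~ gball e v (3 * n).-1 z]) ->
  (m <= M * (4 * n).+1)%N.
Proof.
move=> pl es lf n0 VM Kc Kfar Pc PP PA PK PeA PeK /choice[z zP].
have [|s [sM sZ cov]] := @net _ e M v n (range z) lf n0 VM.
  move=> _ [i _ <-]; have [_ zi _] := zP i; apply: gball_le zi.
  by rewrite leq_mul2r orbT.
apply: (@leq_trans (size s * (4 * n).+1)); last by rewrite leq_mul2r sM orbT.
rewrite -{1}(card_ord m) -cardsT.
apply: (@card_le_cover _ _ (fun y i => `[< balls_meet e n y (z i) >])).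
  move=> i _; have [y ys yi] := cov (z i) (ex_intro2 _ _ i I erefl).
  by apply/hasP; exists y => //; apply/asboolP.
move=> y ys; have [j _ yj] := sZ y ys.
have Ac : walk_connected e (gball e v n).
  by apply: (walk_connected_from es) => x; exact: gball_walk.
have AK : gball e v n `&` K = set0.
  apply/seteqP; split=> // x [vx /Kfar]; apply; apply: gball_le vx.
  by rewrite leq_pmull.
have Pjy : P j y by rewrite -yj; case: (zP j).
have [Q [_ _ _ [_ Qb Qm]]] :=
  saturated_growth pl es Ac Kc AK Pc PP PA PK PeA PeK (2 * n) Pjy.
rewrite mulnA in Qm; apply: leq_trans Qm; apply: subset_leq_card.
apply/fintype.subsetP => i /asboolP[w yw iw]; apply/metP.
exists (z i); split; first by case: (zP i).
pose U := ~` (gball e v n `|` K).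
have nearU j' : gball e (z j') n `<=` U.
  move=> x jx; have [_ z3 z3'] := zP j'; case=> [vx|/Kfar]; [apply: z3'|apply].
    apply: (@gball_le _ _ _ (n + n)); first by lia.
    by apply: gball_trans vx (gball_sym es jx).
  by apply: (@gball_le _ _ _ (3 * n + n)); [lia|exact: gball_trans z3 jx].
apply: Qb; rewrite mul2n -addnn; apply: (@gball_trans _ _ _ w).
  by apply: gball_restrict yw; rewrite -yj.
by apply: gball_sym; [exact: restrict_sym|exact: gball_restrict iw].
Qed.

(** * Cutting off the far components *)

Definition arcs_in (V : choiceType) (e : rel V) (F : set V) : seq (V * V) :=
  [seq (x, y) | x <- fset_set F, y <- [seq y <- fset_set F | e x y]].

Lemma arcs_inP (V : choiceType) (e : rel V) (F : set V) (x y : V) : finite_set F ->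
  edges_rel (arcs_in e F) x y <-> [/\ F x, F y & e x y].
Proof.
move=> Ff; rewrite /edges_rel /arcs_in; split.
  move=> /allpairsPdep[a [b [aF bF [-> ->]]]]; move: aF bF.
  rewrite mem_filter !in_fset_set // => aF /andP[ab bF].
  by split=> //; exact: set_mem.
move=> [Fx Fy xy]; apply/allpairsPdep; exists x, y.
by rewrite mem_filter !in_fset_set // !mem_set // xy.
Qed.

(** Menger's theorem, the linkage being excluded by [crossing_bound]: its paths start
next to the ball of radius [n] and end next to [K], so they cross the sphere of radius
[3 * n]. *)
Lemma small_cut (R : realType) (V : choiceType) (e : rel V) (M : nat)
    (v : V) (n : nat) (K F : set V) :
  planar R e -> symmetric e -> locally_finite e -> (0 < n)%N ->
  (forall a b, volume e a (8 * n) <= M * volume e b n)%N ->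
  walk_connected e K -> K `<=` ~` gball e v (5 * n) ->
  finite_set F -> F `&` gball e v n = set0 -> F `&` K = set0 ->
  exists2 X : seq V, (size X <= M * (4 * n).+1)%N &
    separates (arcs_in e F) [set x | F x /\ exists2 y, gball e v n y & e x y]
      [set x | F x /\ exists2 y, K y & e x y] X.
Proof.
move=> pl es lf n0 VM Kc Kfar Ff FA FK.
set A' := [set x | _]; set B' := [set x | _].
have [//|[D [a [b [Dd DP]]]]] := menger (arcs_in e F) A' B' (M * (4 * n).+1).+1.
suff : ((M * (4 * n).+1).+1 <= M * (4 * n).+1)%N by rewrite ltnn.
pose P i := [set z | walk e (D i `&` F) (a i) z].
have PD i : P i `<=` D i `&` F by move=> z h; have [] := walk_mem h.
have ab i : walk e (D i `&` F) (a i) (b i).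
  have [[Fa _] _ w] := DP i.
  elim: w => [Da|y z _ IH /(arcs_inP _ _ _ Ff)[Fy Fz yz] Dz]; first by apply: walk0.
  by apply: (walkS IH yz).
have Pa i : P i (a i) by apply: walk0; have [] := walk_mem (ab i).
have Pb i : P i (b i) by exact: ab.
have disjF Y i : F `&` Y = set0 -> P i `&` Y = set0.
  by move=> FY; apply/seteqP; split=> // x [/PD[_ Fx] Yx]; exact: setI0_absurd FY Fx Yx.
have Pc i : walk_connected e (P i) by exact: walk_connected_component.
apply: (@crossing_bound R V e M v n K _ P) => //.
- move=> i j ij; apply/seteqP; split=> // x [/PD[Dx _] /PD[Dx' _]].
  exact: setI0_absurd (Dd _ _ ij) Dx Dx'.
- by move=> i; exact: disjF.
- by move=> i; exact: disjF.
- by move=> i; have [[_ [y Ay ey]] _ _] := DP i; exists (a i), y.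
- by move=> i; have [_ [_ [y Ky ey]] _] := DP i; exists (b i), y.
move=> i; have [[_ [y Ay ay]] [Fb [k Kk bk]] _] := DP i.
have [||u [w [Pu u3 w3 uw]]] :=
    walk_exit (B := gball e v (3 * n)) (Pc i _ _ (Pa i) (Pb i)).
- apply: (@gball_le _ _ _ n.+1); first by lia.
  by apply: gball_step Ay _; rewrite es.
- move=> b3; have : gball e v (3 * n).+1 k by exact: gball_step b3 bk.
  have le35 : ((3 * n).+1 <= 5 * n)%N by lia.
  by move=> /(gball_le le35); exact: Kfar.
exists u; split=> // u3'; apply: w3.
by apply: (@gball_le _ _ _ (3 * n).-1.+1); [lia|exact: gball_step u3' uw].
Qed.

Definition induced (V : choiceType) (e : rel V) (e_sym : symmetric e)
    (W : set V) : subgraph e.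
Proof.
exists W (restrict e W); first exact: restrict_sym.
  by move=> x y /and3P[].
by move=> x y /and3P[/set_mem].
Defined.

Theorem theorem2p1 (R : realType) (V : choiceType) (e : rel V)
    (e_sym : symmetric e) (e_irr : irreflexive e)
    (e_lf : locally_finite e)
    (e_doubling : doubling R e) (e_planar : planar R e) :
  exists alpha : R, forall (v : V) (n : nat), (1 <= n)%N ->
    exists Omega : subgraph e,
      [/\ finite_domain Omega,
          gball e v n `<=` sub_vertices Omega,
          boundary Omega `<=` gball e v (6 * n) &
          (nb_vertices (boundary Omega))%:R <= alpha * n%:R].
Proof.
have [M VM] := doubling_volume e_doubling.
exists (M * (M * 5))%:R => v n n0.
have VMn a b := VM a b n n0.
pose A := gball e v n; pose far := ~` gball e v (5 * n).
pose Z := [set z | gball e v (6 * n).+1 z /\ ~ gball e v (6 * n) z].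
have [|s [sM sZ cov]] := @net _ e M v n Z e_lf n0 VMn.
  by move=> z [h _]; apply: gball_le h; lia.
pose K y := [set z | walk e far y z].
have Kfar y : K y `<=` far by move=> z h; have [] := walk_mem h.
(* the components of [far] that contain a point of [Z] *)
pose L := \bigcup_(y in [set` s]) K y.
pose F := gball e v (6 * n) `\` (A `|` L).
have Ff : finite_set F by apply: sub_finite_set (finite_gball v (6 * n) e_lf) => z [].
have /choice[X XP] y : exists X : seq V, (size X <= M * (4 * n).+1)%N /\ (y \in s ->
    separates (arcs_in e F) [set x | F x /\ exists2 y, A y & e x y]
      [set x | F x /\ exists2 z, K y z & e x z] X).
  have [ys|ys] := boolP (y \in s); last by exists [::]; split.
  have [|||||X XM Xs] := @small_cut R V e M v n (K y) F e_planar e_sym e_lf n0 VMn;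
    last by exists X.
  - exact: walk_connected_component.
  - exact: Kfar.
  - exact: Ff.
  - by apply/seteqP; split=> // x [[_ h] Ax]; apply: h; left.
  - by apply/seteqP; split=> // x [[_ h] Kx]; apply: h; right; exists y.
pose XX := flatten [seq X y | y <- s].
pose S := [set` XX] `&` F.
have XXM : (size XX <= M * (M * (4 * n).+1))%N.
  apply: (@leq_trans (size s * (M * (4 * n).+1))); last by rewrite leq_mul2r sM orbT.
  rewrite size_flatten /shape -map_comp sumnE big_map -sum1_size big_distrl /=.
  by apply: leq_sum => y _; rewrite mul1n; case: (XP y).
pose W := [set x | walk e (~` S) v x].
have AS x : A x -> (~` S) x by move=> Ax [_ [_]]; apply; left.
have Sv : (~` S) v by apply: AS; exact: gball0.
pose E := arcs_in e F.
(* A walk from [v] off the cuts stays in [A `|` F]. When it leaves the ball of radius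
   [6 * n], it does so at a point of [Z], hence in some [K y]; and before it first enters
   [K y], its last stretch outside [A] leads from [A] to [K y] inside [F], so it meets the
   cut for [y]. *)
have inv x : W x -> A x \/ exists a, [/\ F a, exists2 y, A y & e a y,
    walk (edges_rel E) (~` [set` XX]) a x & F x].
  elim=> [_|y z _ IH yz Sz]; first by left; exact: gball0.
  have [Az|nAz] := pselect (A z); first by left.
  right; have y6 : gball e v (6 * n) y.
    by case: IH => [|[a [_ _ _ []]] //]; apply: gball_le; lia.
  have nLz : ~ L z.
    case=> y0 /= y0s Kz; case: IH => [Ay|[a [Fa Aa w Fy]]].
      apply: (Kfar _ _ Kz); apply: (@gball_le _ _ _ n.+1); first by lia.
      exact: gball_step Ay yz.
    have [_ /(_ y0s a y)] := XP y0; apply; [by split|by split=> //; exists z|].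
    apply: walkW w => u nu Xu; apply: nu; apply/flattenP.
    by exists (X y0); [exact: map_f|].
  have z6 : gball e v (6 * n) z.
    apply: contrapT => z6; have Zz : Z z by split=> //; exact: gball_step y6 yz.
    have [y0 y0s meet] := cov z Zz; apply: nLz; exists y0 => //.
    have [_ y06] := sZ y0 y0s.
    by apply: balls_meet_walk meet _ _ => //; rewrite -mulSnr.
  have Fz : F z by split=> // -[].
  have XXz : (~` [set` XX]) z by move=> h; apply: Sz.
  case: IH => [Ay|[a [Fa Aa w Fy]]].
    by exists z; split=> //; [exists y; rewrite 1?e_sym|exact: walk0].
  by exists a; split=> //; apply: (walkS w) => //; apply/arcs_inP.
have bS : boundary (induced e_sym W) `<=` S.
  move=> x [/= nWx [y Wy xy]]; apply: contrapT => nS; apply: nWx.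
  by apply: (walkS Wy) => //; rewrite e_sym.
exists (induced e_sym W); split.
- split=> /=.
    apply: sub_finite_set (finite_gball v (6 * n) e_lf) => x /inv[|[a [_ _ _ []]] //].
    by apply: gball_le; lia.
  move=> x y /= Wx Wy.
  have w : walk (restrict e W) W x y.
    apply: walk_sub (walk_connected_component e_sym Wx Wy) => // u z uW zW uz.
    by rewrite /restrict uW zW.
  by have [p [? ? _]] := walk_path w; exists p.
- move=> x Ax; apply: walkW AS _; exact: gball_walk.
- by move=> x /bS[_ []].
rewrite -natrM ler_nat; apply: (@leq_trans (size XX)); last first.
  apply: leq_trans XXM _; rewrite -!mulnA !leq_mul2l.
  by apply/orP; right; apply/orP; right; lia.
apply: (@leq_trans (size (undup XX))); last exact: size_undup.
rewrite /nb_vertices -card_fseq; apply: fsubset_leq_card; apply/fsubsetP => x.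
rewrite in_fset_set; last by apply: sub_finite_set Ff => z /bS[].
by move=> /set_mem/bS[]; rewrite inE.
Qed.
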